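(* Let $p\geq 5$. Then there is no commutator-free exponential integrator of convergence order $p$ with real coefficients $a_{j,k}$ that satisfies the positivity condition. That is, there do not exist integers $J,K\geq 1$, real coefficients $a_{j,k}\in\mathbb{R}$ ($j=1,\dots,J$, $k=1,\dots,K$) and real nodes $c_1,\dots,c_K\in\mathbb{R}$ such that both of the following hold: (i) the commutator-free exponential integrator $$u_{n+1}=\mathrm{e}^{\tau B_J(t_n,\tau)}\cdots \mathrm{e}^{\tau B_1(t_n,\tau)}u_n,\qquad B_j(t_n,\tau)=\sum_{k=1}^{K}a_{j,k}A(t_n+c_k\tau),\quad j=1,\dots,J,$$ has convergence order $p$; (ii) $b_j:=\sum_{k=1}^{K}a_{j,k}>0$ for all $j=1,\dots,J$.
   Context: Consider linear non-autonomous initial value problems $u'(t)=A(t)u(t)$, $u(t_0)=u_0$, $t\in[t_0,T]$, with $A(t)\in\mathbb{C}^{d\times d}$ and $u_0\in\mathbb{C}^d$. For a step-size $\tau>0$ and grid points $t_n=t_0+n\tau$, $n=0,1,\dots$, a commutator-free exponential integrator with $J$ exponentials, coefficients $a_{j,k}$ and nodes $c_k$ (all fixed, independent of the problem and of $\tau$) computes approximations $u_n\approx u(t_n)$, starting from the initial value $u_0$, by the recursion displayed in the claim, where $\mathrm{e}^{M}$ is the matrix exponential. The integrator has convergence order $p$ if $\|u_n-u(t_n)\|=O(\tau^p)$ for all such problems, i.e. if for every $d\geq 1$, every $t_0<T$, every smooth ($C^\infty$) function $A:\mathbb{R}\to\mathbb{C}^{d\times d}$ and every $u_0\in\mathbb{C}^d$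 there exist constants $C,\tau_0>0$ such that $\|u_n-u(t_n)\|\leq C\tau^p$ for all $0<\tau\leq\tau_0$ and all integers $n\geq 0$ with $t_0+n\tau\leq T$, where $u$ is the exact solution. *)

(* Defs.v *)
From HB Require Import structures.
From mathcomp Require Import all_boot all_order all_algebra.
From mathcomp Require Import all_classical all_reals all_analysis.
From mathcomp Require Import complex.

Set Implicit Arguments.
Unset Strict Implicit.
Unset Printing Implicit Defensive.

Import Order.TTheory GRing.Theory Num.Theory.
Import numFieldNormedType.Exports.

Local Open Scope classical_set_scope.
Local Open Scope ring_scope.
Local Open Scope complex_scope.

(* The topology of R[i] is the one MathComp-Analysis gives to every
   numFieldType: the balls of its own (R[i]-valued) norm. *)
HB.instance Definition _ (R : realType) := NormedModule.copy R[i] R[i]^o.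

Definition expmx (R : realType) (d : nat) (M : 'M[R[i]]_d) : 'M[R[i]]_d :=
  limn (series (fun n : nat => (n`!%:R : R[i])^-1 *: M ^+ n)).

(* [f] has derivative [L] at [t] relative to [D].  MathComp-Analysis has no
   structure of normed module over R on complex matrices, hence the explicit
   difference quotient, with limit in the topology of 'M[R[i]]_(m, n).
   When [D] is a compact interval this is the one-sided derivative at its
   endpoints. *)
Definition has_derivative (R : realType) (m n : nat) (D : set R)
    (f : R -> 'M[R[i]]_(m, n)) (t : R) (L : 'M[R[i]]_(m, n)) : Prop :=
  ((s - t)^-1)%:C *: (f s - f t) @[s --> within D t^'] --> L.

(* C^oo on the whole real line: [F k] is the k-th derivative of [A]. *)
Definition smooth (R : realType) (m n : nat) (A : R -> 'M[R[i]]_(m, n)) : Prop :=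
  exists F : nat -> R -> 'M[R[i]]_(m, n),
    F 0%N = A /\ forall k t, has_derivative setT (F k) t (F k.+1 t).

Definition ivp_solution (R : realType) (d : nat) (A : R -> 'M[R[i]]_d)
    (t0 T : R) (u0 : 'cV[R[i]]_d) (u : R -> 'cV[R[i]]_d) : Prop :=
  u t0 = u0 /\
  forall t, t \in `[t0, T] -> has_derivative `[t0, T] u t (A t *m u t).

Section Integrator.
Variables (R : realType) (J K : nat) (a : 'I_J -> 'I_K -> R) (c : 'I_K -> R).

Definition cfei_B (d : nat) (A : R -> 'M[R[i]]_d) (j : 'I_J) (t tau : R) :
    'M[R[i]]_d :=
  \sum_(k < K) (a j k)%:C *: A (t + c k * tau).

(* Matrices do not commute: [rev_ord] puts the factor with the largest index
   leftmost. *)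
Definition cfei_step (d : nat) (A : R -> 'M[R[i]]_d) (t tau : R) : 'M[R[i]]_d :=
  \prod_(j < J) expmx (tau%:C *: cfei_B A (rev_ord j) t tau).

Fixpoint cfei_approx (d : nat) (A : R -> 'M[R[i]]_d) (t0 tau : R)
    (u0 : 'cV[R[i]]_d) (n : nat) : 'cV[R[i]]_d :=
  if n is n'.+1 then
    cfei_step A (t0 + n'%:R * tau) tau *m cfei_approx A t0 tau u0 n'
  else u0.

(* The norm is the maximum norm on C^d; it takes its values in R[i]. *)
Definition convergence_order (p : nat) : Prop :=
  forall (d : nat) (t0 T : R) (A : R -> 'M[R[i]]_d) (u0 : 'cV[R[i]]_d)
    (u : R -> 'cV[R[i]]_d),
    (0 < d)%N -> t0 < T -> smooth A -> ivp_solution A t0 T u0 u ->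
    exists C tau0 : R, [/\ 0 < C, 0 < tau0 &
      forall (tau : R) (n : nat), 0 < tau -> tau <= tau0 ->
        t0 + n%:R * tau <= T ->
        `|cfei_approx A t0 tau u0 n - u (t0 + n%:R * tau)|
          <= (C * tau ^+ p)%:C].

Definition positivity_condition : Prop :=
  forall j : 'I_J, 0 < \sum_(k < K) a j k.

End Integrator.

(* Main.v *)
Require Import Defs.
From mathcomp Require Import all_boot all_order all_algebra.
From mathcomp Require Import all_classical all_reals all_analysis.
From mathcomp Require Import complex.
From mathcomp Require Import ring lra.

(* Since b_j > 0, one step of the integrator applied to u' = (P + t Q) u is the
   exact flow of u' = (P + g(s) Q) u for a piecewise constant function g of a
   time variable s running forward.  On a nilpotent problem, the polynomial
   functional [int_0^1 (G(s) - s^2/2)^2 ds], with G' = g and G(0) = 0, can be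
   read off the components of the solution at the end point.  It vanishes for
   the exact solution, where g(s) = s, so order p >= 5 forces it to be
   O(tau^5).  But on every interval where G is affine the integrand is the
   square of a quadratic polynomial with leading coefficient -1/2, so that each
   exponential contributes at least (tau b_j)^5/720; over 1/tau steps this adds
   up to a positive multiple of tau^4. *)

Set Implicit Arguments.
Unset Strict Implicit.
Unset Printing Implicit Defensive.

Import Order.TTheory GRing.Theory Num.Theory.
Import numFieldNormedType.Exports.

Local Open Scope classical_set_scope.
Local Open Scope ring_scope.
Local Open Scope complex_scope.

(** * The nilpotent test problem and its exponentials *)

Lemma expmx_nilpotent (R : realType) (d m : nat) (M : 'M[R[i]]_d) :
  M ^+ m = 0 -> expmx M = \sum_(k < m) (k`!%:R)^-1 *: M ^+ k.
Proof.
move=> Mm0; apply: cvg_lim; first exact: norm_hausdorff.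
apply: cvg_near_cst; exists m => // n /= le_mn.
rewrite /series /= (big_cat_nat (leq0n m) le_mn) /= [X in _ + X]big_nat.
rewrite [X in _ + X]big1 ?addr0 ?big_mkord // => k /andP[le_mk _].
by rewrite -(subnKC le_mk) exprD Mm0 mul0r scaler0.
Qed.

(** Short lists are padded with zeros, so the initial value is [cvec [:: 1]]. *)
Definition cvec (R : realType) (l : seq R) : 'cV[R[i]]_8 :=
  \col_i (nth 0 l i)%:C.

(** A pair [(i, j)] lets component [j] drive the derivative of component [i]. *)
Definition adjmx (R : realType) (s : seq (nat * nat)) : 'M[R[i]]_8 :=
  \matrix_(i, j) (((i : nat), (j : nat)) \in s)%:R.

(* The components are ordered as (1, S, G, X2, X3, X4, Y2, Y3), with
   S' = b, G' = q, X2' = b G, X3' = b X2, X4' = b X3, Y2' = q G, Y3' = b Y2;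
   the test problem is A(t) = flowmx 1 t. *)
Definition flowmx (R : realType) (b q : R) : 'M[R[i]]_8 :=
  b%:C *: adjmx R [:: (1, 0); (3, 2); (4, 3); (5, 4); (7, 6)]%N
  + q%:C *: adjmx R [:: (2, 0); (6, 2)]%N.

Lemma mul_flowmx (R : realType) (b q x0 x1 x2 x3 x4 x5 x6 x7 : R) :
  flowmx b q *m cvec [:: x0; x1; x2; x3; x4; x5; x6; x7] =
  cvec [:: 0; b * x0; q * x0; b * x2; b * x3; b * x4; q * x2; b * x6].
Proof.
apply/colP => i; rewrite !mxE !big_ord_recl big_ord0 !mxE.
case: i => [[|[|[|[|[|[|[|[|//]]]]]]]] ?] /=;
  by rewrite !(mulr0, mulr1, mul0r, addr0, add0r, rmorphM, rmorph0).
Qed.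

(** The longest dependency chain, 1, G, X2, X3, X4, has four links. *)
Lemma flowmx_nilpotent (R : realType) (b q : R) : flowmx b q ^+ 5 = 0.
Proof.
apply/matrixP => i j.
(* Applying the power to the [j]-th unit vector reduces the claim to iterating [mul_flowmx]. *)
have -> : (flowmx b q ^+ 5) i j
    = (flowmx b q ^+ 5 *m cvec (mkseq (fun k => (k == j)%:R) 8)) i 0.
  have e k : (cvec (mkseq (fun k => (k == j)%:R) 8) : 'cV[R[i]]_8) k 0
      = (k == j)%:R by rewrite mxE nth_mkseq // rmorph_nat.
  rewrite [RHS]mxE (bigD1 j) // e eqxx mulr1 big1 => [|k /andP[_ /negbTE kj]].
    exact/esym/addr0.
  by rewrite e kj mulr0.
rewrite !exprS expr0 mulr1 -!mulmxE -!mulmxA /=.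
rewrite !mul_flowmx !mxE.
by case: i => [[|[|[|[|[|[|[|[|//]]]]]]]] ?] /=; rewrite !(mulr0, rmorph0).
Qed.

Lemma expmx_flowmx (R : realType) (b q x0 x1 x2 x3 x4 x5 x6 x7 : R) :
  expmx (flowmx b q) *m cvec [:: x0; x1; x2; x3; x4; x5; x6; x7] =
  cvec [:: x0; x1 + b * x0; x2 + q * x0;
           x3 + b * x2 + b * q * x0 / 2;
           x4 + b * x3 + b ^+ 2 * x2 / 2 + b ^+ 2 * q * x0 / 6;
           x5 + b * x4 + b ^+ 2 * x3 / 2 + b ^+ 3 * x2 / 6
              + b ^+ 3 * q * x0 / 24;
           x6 + q * x2 + q ^+ 2 * x0 / 2;
           x7 + b * x6 + b * q * x2 / 2 + b * q ^+ 2 * x0 / 6].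
Proof.
rewrite (expmx_nilpotent (flowmx_nilpotent b q)).
rewrite mulmx_suml !big_ord_recr big_ord0 /= -!scalemxAl.
rewrite !exprS expr0 mulr1 mul1mx -!mulmxE -!mulmxA !mul_flowmx.
have factV n : (n`!%:R : R[i])^-1 = ((n`!%:R : R)^-1)%:C.
  by rewrite fmorphV rmorph_nat.
have [f2 [f3 f4]] : 2`! = 2%N /\ 3`! = 6%N /\ 4`! = 24%N by [].
apply/colP => i; rewrite !mxE !factV.
case: i => [[|[|[|[|[|[|[|[|//]]]]]]]] ?] /=;
  rewrite -!rmorphM -!rmorphD; congr (_%:C); rewrite f2 f3 f4 fact0; by field.
Qed.

(** * Growth of the defect along the integrator *)

(* Integration by parts gives
   [int (G - s^2/2)^2 = 2 int G^2/2 - S^2 X2 + 2 S X3 - 2 X4 + S^5/20],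
   where X2, X3, X4 are the iterated integrals of G over [0, S] and Y3 is the
   integral of G^2/2. *)
Definition defect (R : realType) (S X2 X3 X4 Y3 : R) : R :=
  2 * Y3 - S ^+ 2 * X2 + 2 * S * X3 - 2 * X4 + S ^+ 5 / 20.

(** The invariant of the induction over exponentials. The relation Y2 = G^2/2 persists because
    (G^2/2)' = q G; it makes Y3 the integral of G^2/2. *)
Definition defect_ge (R : realType) (D : R) (v : 'cV[R[i]]_8) : Prop :=
  exists S G X2 X3 X4 Y3 : R,
    v = cvec [:: 1; S; G; X2; X3; X4; G ^+ 2 / 2; Y3]
    /\ D <= defect S X2 X3 X4 Y3.

Lemma defect_ge_expmx (R : realType) (b q D : R) (v : 'cV[R[i]]_8) :
  0 <= b -> defect_ge D v ->
  defect_ge (D + b ^+ 5 / 720) (expmx (flowmx b q) *m v).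
Proof.
move=> b_ge0 [S [G [X2 [X3 [X4 [Y3 [-> leD]]]]]]]; rewrite expmx_flowmx.
exists (S + b), (G + q), (X2 + b * G + b * q / 2),
  (X3 + b * X2 + b ^+ 2 * G / 2 + b ^+ 2 * q / 6),
  (X4 + b * X3 + b ^+ 2 * X2 / 2 + b ^+ 3 * G / 6 + b ^+ 3 * q / 24),
  (Y3 + b * (G ^+ 2 / 2) + b * q * G / 2 + b * q ^+ 2 / 6); split.
  rewrite !mulr1; congr (cvec [:: _; _; _; _; _; _; _; _]); by field.
(* With r(s) = G + s q/b - (S + s)^2/2 on [0, b], m is the mean of r and l its
   linear Legendre coefficient; int r^2 is the sum of three Legendre squares. *)
set m := G - S ^+ 2 / 2 + (q - S * b) / 2 - b ^+ 2 / 6.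
set l := q - S * b - b ^+ 2 / 2.
apply: (@le_trans _ _
  (defect S X2 X3 X4 Y3 + b * (m ^+ 2 + l ^+ 2 / 12 + b ^+ 4 / 720))).
  apply: lerD => //; rewrite exprS -mulrA ler_wpM2l // lerDr.
  by rewrite addr_ge0 ?divr_ge0 ?sqr_ge0.
by rewrite le_eqVlt; apply/orP; left; apply/eqP; rewrite /defect /m /l; field.
Qed.

(** [flowmx] is linear in (b, q), so every exponent stays in the family, with tau b_j as elapsed
    time. *)
Lemma cfei_B_flowmx (R : realType) (J K : nat) (a : 'I_J -> 'I_K -> R)
    (c : 'I_K -> R) (j : 'I_J) (t tau : R) :
  tau%:C *: cfei_B a c (flowmx 1) j t tau
  = flowmx (tau * \sum_k a j k) (tau * \sum_k a j k * (t + c k * tau)).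
Proof.
rewrite /cfei_B /flowmx; under eq_bigr do rewrite scalerDr !scalerA -!rmorphM.
rewrite big_split /= -!scaler_suml scalerDr !scalerA -!rmorph_sum -!rmorphM /=.
by under eq_bigr do rewrite mulr1.
Qed.

Lemma defect_ge_cfei_step (R : realType) (J K : nat) (a : 'I_J -> 'I_K -> R)
    (c : 'I_K -> R) (t tau D : R) (v : 'cV[R[i]]_8) :
  positivity_condition a -> 0 <= tau -> defect_ge D v ->
  defect_ge (D + tau ^+ 5 * \sum_j (\sum_k a j k) ^+ 5 / 720)
    (cfei_step a c (flowmx 1) t tau *m v).
Proof.
move=> apos tau_ge0 Dv.
(* Reversing the sum pairs each summand with its factor, so that one induction on the index list
   peels off both. *)
rewrite (reindex_inj rev_ord_inj) /= /cfei_step.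
elim: (index_enum _) => [|j r IHr]; first by rewrite !big_nil mulr0 addr0 mul1mx.
rewrite !big_cons -mulmxE -mulmxA cfei_B_flowmx.
have -> : D + tau ^+ 5 * ((\sum_k a (rev_ord j) k) ^+ 5 / 720
    + \sum_(j <- r) (\sum_k a (rev_ord j) k) ^+ 5 / 720)
  = D + tau ^+ 5 * (\sum_(j <- r) (\sum_k a (rev_ord j) k) ^+ 5 / 720)
    + (tau * \sum_k a (rev_ord j) k) ^+ 5 / 720 by rewrite exprMn; ring.
by apply: defect_ge_expmx => //; rewrite mulr_ge0 // ltW.
Qed.

Lemma defect_ge_cfei_approx (R : realType) (J K : nat) (a : 'I_J -> 'I_K -> R)
    (c : 'I_K -> R) (t0 tau D : R) (u0 : 'cV[R[i]]_8) (n : nat) :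
  positivity_condition a -> 0 <= tau -> defect_ge D u0 ->
  defect_ge (D + n%:R * (tau ^+ 5 * \sum_j (\sum_k a j k) ^+ 5 / 720))
    (cfei_approx a c (flowmx 1) t0 tau u0 n).
Proof.
move=> apos tau_ge0 Du0; elim: n => [|n IHn] /=; first by rewrite mul0r addr0.
by rewrite -natr1 mulrDl mul1r addrA; apply: defect_ge_cfei_step.
Qed.

(** * Polynomial matrix functions, and the exact solution *)

Definition polymx (R : realType) (m n : nat) (P : 'M[{poly R}]_(m, n)) (s : R) :
    'M[R[i]]_(m, n) :=
  map_mx (fun p : {poly R} => p.[s]%:C) P.

Lemma polymx_continuous (R : realType) (m n : nat) (P : 'M[{poly R}]_(m, n)) :
  continuous (polymx P).
Proof.
move=> t; apply/cvg_ballP => e e_gt0.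
(* The radius lies in [R[i]]; being positive, it is real. *)
have eE : e = (complex.Re e)%:C by rewrite RRe_real // gtr0_real.
have Re_gt0 : 0 < complex.Re e by rewrite -ltcR -eE.
have Pt (ij : 'I_m * 'I_n) : \forall s \near t,
    `|(P ij.1 ij.2).[t] - (P ij.1 ij.2).[s]| < complex.Re e.
  by have /cvgrPdist_lt := @continuous_horner R (P ij.1 ij.2) t; apply.
have {}Pt := filter_forall _ Pt; near=> s; split=> // i j.
have Ps : forall ij : 'I_m * 'I_n,
    `|(P ij.1 ij.2).[t] - (P ij.1 ij.2).[s]| < complex.Re e by near: s; exact: Pt.
rewrite -ball_normE /= !mxE -rmorphB eE normc_def /= expr0n addr0 sqrtr_sqr ltcR.
exact: (Ps (i, j)).
Unshelve. all: by end_near. Qed.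

Lemma polymx_derivative (R : realType) (m n : nat) (P : 'M[{poly R}]_(m, n))
    (D : set R) (t : R) :
  has_derivative D (polymx P) t (polymx (map_mx (@deriv R) P) t).
Proof.
(* By the factor theorem the difference quotient at s is Q(s), which is continuous, and Q(t) =
   P'(t). *)
have [Q QE] : exists Q : 'M[{poly R}]_(m, n), forall i j,
    P i j = Q i j * ('X - t%:P) + (P i j).[t]%:P.
  exists (map_mx (fun p => (p - p.[t]%:P) %/ ('X - t%:P)) P) => i j.
  by rewrite !mxE divpK ?subrK // dvdp_XsubCl rootE !hornerE subrr.
have -> : polymx (map_mx (@deriv R) P) t = polymx Q t.
  apply/matrixP => i j; rewrite !mxE (QE i j) derivD derivM derivB derivX !derivC.
  by rewrite !hornerE subrr mulr0 add0r subr0 mulr1.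
rewrite /has_derivative.
apply: (@cvg_trans _ (polymx Q s @[s --> within D t^'])); last first.
  apply: cvg_trans (@polymx_continuous _ _ _ Q t); apply: cvg_app.
  by apply: cvg_trans; [exact: cvg_within|exact: nbhs_dnbhs].
apply: near_eq_cvg; near=> s.
have st : s - t != 0.
  by rewrite subr_eq0; near: s; apply: cvg_within; exact: (@nbhs_dnbhs_neq R t).
apply/matrixP => i j; rewrite !mxE -rmorphB -rmorphM; congr (_%:C).
rewrite (QE i j) !hornerE; by field.
Unshelve. all: by end_near. Qed.

Lemma polymx_smooth (R : realType) (m n : nat) (P : 'M[{poly R}]_(m, n)) :
  smooth (polymx P).
Proof.
exists (fun k => polymx (iter k (map_mx (@deriv R)) P)); split => // k t.
exact: polymx_derivative.
Qed.

Lemma flowmx_smooth (R : realType) : smooth (@flowmx R 1).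
Proof.
pose P : 'M[{poly R}]_8 := \matrix_(i, j)
  ((((i : nat), (j : nat)) \in [:: (1, 0); (3, 2); (4, 3); (5, 4); (7, 6)]%N)%:R
   + 'X * (((i : nat), (j : nat)) \in [:: (2, 0); (6, 2)]%N)%:R).
suff -> : flowmx 1 = polymx P by exact: polymx_smooth.
apply/funext => t; apply/matrixP => i j.
by rewrite !mxE !hornerE !hornerMn !hornerE rmorphD rmorphM !rmorph_nat.
Qed.

Definition exact_sol (R : realType) (t : R) : 'cV[R[i]]_8 :=
  cvec [:: 1; t; t ^+ 2 / 2; t ^+ 3 / 6; t ^+ 4 / 24; t ^+ 5 / 120;
           t ^+ 4 / 8; t ^+ 5 / 40].

Lemma exact_sol_ivp (R : realType) :
  ivp_solution (@flowmx R 1) 0 1 (cvec [:: 1]) (@exact_sol R).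
Proof.
split.
  apply/colP => i; rewrite !mxE; congr (_%:C).
  by case: i => [[|[|[|[|[|[|[|[|//]]]]]]]] ?] /=; rewrite ?expr0n ?mul0r.
move=> t _.
pose l := [:: 1; 'X; (2^-1)%:P * 'X^2; (6^-1)%:P * 'X^3; (24^-1)%:P * 'X^4;
  (120^-1)%:P * 'X^5; (8^-1)%:P * 'X^4; (40^-1)%:P * 'X^5] : seq {poly R}.
pose P : 'cV[{poly R}]_8 := \col_i nth 0 l i.
have solE : @exact_sol R = polymx P.
  apply/funext => s; apply/colP => i; rewrite !mxE; congr (_%:C).
  by case: i => [[|[|[|[|[|[|[|[|//]]]]]]]] ?] /=;
    rewrite ?hornerCM ?hornerXn ?hornerX ?hornerC; field.
suff -> : flowmx 1 t *m exact_sol t = polymx (map_mx (@deriv R) P) t.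
  by rewrite solE; exact: polymx_derivative.
rewrite mul_flowmx; apply/colP => i; rewrite !mxE; congr (_%:C).
case: i => [[|[|[|[|[|[|[|[|//]]]]]]]] ?] /=;
  rewrite ?derivM ?derivXn ?derivX ?derivC !(hornerE, hornerMn) /=; by field.
Qed.

(** * Comparison with the exact solution at time 1 *)

(** The defect vanishes at the exact end values. Expanded around them, it has no constant term, each
    monomial is at most e in absolute value as e <= 1, and the absolute values of the coefficients
    sum to less than 15. *)
Lemma defect_le (R : realType) (e S X2 X3 X4 Y3 : R) :
  e <= 1 -> `|S - 1| <= e -> `|X2 - 1 / 6| <= e -> `|X3 - 1 / 24| <= e ->
  `|X4 - 1 / 120| <= e -> `|Y3 - 1 / 40| <= e ->
  defect S X2 X3 X4 Y3 <= 15 * e.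
Proof.
move=> e1; rewrite /defect.
rewrite -{2 3 4}(subrK 1 S) -{2}(subrK (1 / 6) X2) -{2}(subrK (1 / 24) X3).
rewrite -{2}(subrK (1 / 120) X4) -{2}(subrK (1 / 40) Y3).
set s := S - 1; set x2 := X2 - _; set x3 := X3 - _; set x4 := X4 - _.
set y3 := Y3 - _ => hs h2 h3 h4 h5.
have e0 : 0 <= e by apply: le_trans hs.
have mul x y : `|x| <= e -> `|y| <= e -> `|x * y| <= e.
  move=> hx hy; rewrite normrM -[e]mulr1 ler_pM //.
  exact: le_trans hy e1.
have hss := mul _ _ hs hs; have hsss := mul _ _ hs hss.
have hssss := mul _ _ hs hsss; have hsssss := mul _ _ hs hssss.
have hs2 := mul _ _ hs h2; have hss2 := mul _ _ hs hs2.
have hs3 := mul _ _ hs h3.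
move: hs h2 h3 h4 h5 hss hsss hssss hsssss hs2 hss2 hs3.
rewrite !ler_norml => *; lra.
Qed.

Lemma cvec_dist (R : realType) (l l' : seq R) (e : R) (i : 'I_8) :
  `|cvec l - cvec l'| <= e%:C -> `|nth 0 l i - nth 0 l' i| <= e.
Proof.
move=> le_e; rewrite -lecR; apply: le_trans le_e.
have -> : (`|nth 0 l i - nth 0 l' i|)%:C = `|(cvec l - cvec l') i 0|.
  by rewrite !mxE -rmorphB normc_def /= expr0n addr0 sqrtr_sqr.
rewrite [leRHS]/Num.norm /= mx_normE.
rewrite -[leLHS]nngE num_le.
exact: (le_bigmax _ (fun ij => `|(cvec l - cvec l') ij.1 ij.2|%:nng) (i, 0)).
Qed.

Theorem theorem1 (R : realType) (p : nat) (hp : (5 <= p)%N) :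
  ~ exists (J K : nat) (a : 'I_J -> 'I_K -> R) (c : 'I_K -> R),
      [/\ (1 <= J)%N, (1 <= K)%N,
          convergence_order a c p & positivity_condition a].
Proof.
case=> J [K] [a] [c] [J1 _ conv apos].
set beta := \sum_j (\sum_k a j k) ^+ 5 / 720.
have term_gt0 j : 0 < (\sum_k a j k) ^+ 5 / 720.
  by apply: divr_gt0; [exact: exprn_gt0 (apos j) | exact: ltr0n].
have beta_gt0 : 0 < beta.
  rewrite /beta (bigD1 (Ordinal J1) isT).
  apply: ltr_pwDl; first exact: term_gt0.
  by apply: sumr_ge0 => j _; exact: ltW (term_gt0 j).
have [C [tau0 [C_gt0 tau0_gt0 err]]] := conv 8%N 0 1 _ _ _ isT ltr01
  (@flowmx_smooth R) (@exact_sol_ivp R).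
(* For tau = 1/N with N > M, the three summands give tau <= tau0, C tau <= 1 and 15 C tau < beta
   respectively. *)
pose M := tau0^-1 + C + 15 * C / beta.
have tau0V_gt0 : 0 < tau0^-1 by rewrite invr_gt0.
have Cbeta_gt0 : 0 < 15 * C / beta by rewrite divr_gt0 ?mulr_gt0.
have M_gt0 : 0 < M by rewrite !addr_gt0.
pose N := Num.bound M.
have N_gt : M < N%:R by apply: archi_boundP; exact: ltW.
have N_gt0 : 0 < N%:R :> R by apply: lt_trans N_gt.
pose tau : R := N%:R^-1.
have tau_gt0 : 0 < tau by rewrite invr_gt0.
have Ntau : N%:R * tau = 1 by rewrite mulfV // gt_eqF.
have N_ge1 : 1 <= N%:R :> R by rewrite ler1n -(ltr0n R).
have tau_le1 : tau <= 1 by rewrite invf_le1.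
have tau_le : tau <= tau0.
  by rewrite -[tau0]invrK lef_pV2 ?posrE //; rewrite /M in N_gt; lra.
have Ctau : C * tau <= 1.
  by rewrite ler_pdivrMr // mul1r; rewrite /M in N_gt; lra.
have Cbeta : 15 * C * tau < beta.
  rewrite ltr_pdivrMr // -ltr_pdivrMl //; rewrite /M in N_gt; lra.
clearbody tau.
have := err tau N tau_gt0 tau_le; rewrite add0r Ntau => /(_ (lexx _)).
have : defect_ge 0 (cvec [:: 1] : 'cV[R[i]]_8).
  exists 0, 0, 0, 0, 0, 0; split; last by rewrite /defect; lra.
  apply/colP => i; rewrite !mxE; congr (_%:C).
  by case: i => [[|[|[|[|[|[|[|[|//]]]]]]]] ?] /=; rewrite ?expr0n ?mul0r.
move/(defect_ge_cfei_approx c 0 N apos (ltW tau_gt0)).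
rewrite add0r => -[S [G [X2 [X3 [X4 [Y3 [-> leD]]]]]]] dist.
set e := C * tau ^+ 5.
have le_e : C * tau ^+ p <= e.
  by rewrite ler_wpM2l ?(ltW C_gt0) // ler_wiXn2l // ltW.
have e_le1 : e <= 1.
  rewrite /e exprS mulrA -[1]mulr1 ler_pM ?exprn_ge0 ?exprn_ile1 //; try exact: ltW.
  by rewrite mulr_ge0 ?ltW.
have {}dist := le_trans dist (_ : _ <= e%:C); rewrite lecR in dist.
have dist' i (ltin : (i < 8)%N) := cvec_dist (Ordinal ltin) (dist le_e).
have /= d1 := dist' 1%N isT; have /= d3 := dist' 3%N isT.
have /= d4 := dist' 4%N isT; have /= d5 := dist' 5%N isT.
have /= d7 := dist' 7%N isT; rewrite !expr1n in d1 d3 d4 d5 d7.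
have := le_trans leD (defect_le e_le1 d1 d3 d4 d5 d7).
(* As N tau = 1, the bounds combine to tau^4 beta <= 15 C tau^5, against [Cbeta]. *)
rewrite -/beta (_ : N%:R * _ = N%:R * tau * (tau ^+ 4 * beta)); last by ring.
rewrite Ntau mul1r.
rewrite (_ : 15 * e = tau ^+ 4 * (15 * C * tau)); last by rewrite /e; ring.
by rewrite ler_pM2l ?exprn_gt0 // leNgt Cbeta.
Qed.
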